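(* Let $G$ be a connected weighted undirected graph on $n$ vertices. Denote the proportion of negative and positive entries $v_{*i}(\alpha)$ of the vector $v_*(\alpha)$ as $\mu:1-\mu$ (i.e. a fraction $\mu$ of the $n$ entries is negative and a fraction $1-\mu$ is positive). Then, for sufficiently small $\alpha$, if $$\gamma(P)<\min(\mu,1-\mu),$$ the relaxation time $1/\gamma(P(\alpha))$ decreases with respect to $\alpha$.
   Context: $G$ is a connected weighted undirected graph with vertex set $\{1,\dots,n\}$ and symmetric weighted adjacency matrix $A=(a_{ij})$, where $a_{ij}>0$ is the weight of edge $(i,j)$ if $i\sim j$ and $a_{ij}=0$ otherwise (weighted self-loops are not excluded). $\underline{1}$ is the column vector of ones, $d=A\underline{1}$ is the vector of weighted degrees, $D=\mathrm{Diag}(d)$. The standard random walk has transition matrix $P=D^{-1}A$. For $\alpha\ge 0$ the random walk with jumps has transition matrix $P(\alpha)=(D+\alpha I)^{-1}\left(A+\frac{\alpha}{n}\underline{1}\,\underline{1}^T\right)$, so $P(0)=P$. The eigenvalues of $P(\alpha)$ are real and lie in $[-1,1]$. $\lambda_*(\alpha)$ denotes the maximum modulus eigenvalue of $P(\alpha)$ different from $+1$ and $-1$, and $v_*(\alpha)=(v_{*1}(\alpha),\dots,v_{*n}(\alpha))^T$ a corresponding eigenvector: $P(\alpha)v_*(\alpha)=\lambda_*(\alpha)v_*(\alpha)$. The spectral gap is $\gamma(P(\alpha))=1-|\lambda_*(\alpha)|$, $\gamma(P)=\gamma(P(0))$, and the relaxation time is $1/\gamma(P(\alpha))$.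
   Formalization: When −1 is an eigenvalue of P (bipartite G), the decrease is claimed only for small α > 0, not starting from α = 0, where the claim fails because the excluded eigenvalue −1 becomes λ_*(α) just above −1 (e.g. the 8-cycle). *)

(* Defs.v *)
From mathcomp Require Import all_boot all_order all_algebra.
From mathcomp Require Import boolp classical_sets reals.

Set Implicit Arguments.
Unset Strict Implicit.
Unset Printing Implicit Defensive.

Import Order.TTheory GRing.Theory Num.Theory.
Local Open Scope ring_scope.

Section Defs.
Variables (R : realType) (n : nat).
Implicit Types (A M : 'M[R]_n) (v : 'cV[R]_n).

(* Diagonal entries are unconstrained beyond nonnegativity: self-loops are
   allowed. *)
Definition connected_weighted_graph A : Prop :=
  [/\ A^T = A,
      forall i j, 0 <= A i j &
      forall i j, connect [rel k l | 0 < A k l] i j].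

Definition ones : 'cV[R]_n := const_mx 1.

Definition degree A : 'cV[R]_n := A *m ones.

Definition jump_walk A (alpha : R) : 'M[R]_n :=
  invmx (diag_mx (degree A)^T + alpha%:M)
    *m (A + (alpha / n%:R) *: (ones *m ones^T)).

(* Only eigenvalues in [R] are considered; this loses nothing for
   [jump_walk A alpha], whose spectrum is real.  [eigenvalue] is phrased with
   row eigenvectors, which gives the same set of eigenvalues. *)
Definition is_lambda_star M (l : R) : Prop :=
  [/\ eigenvalue M l, l != 1, l != -1 &
      forall l', eigenvalue M l' -> l' != 1 -> l' != -1 -> `|l'| <= `|l|].

(* The modulus does not depend on which maximiser is picked.  When 1 and -1 are
   the only eigenvalues the gap takes the conventional value 1. *)
Definition spectral_gap M : R :=
  1 - `|xget 0 [set l | is_lambda_star M l]%classic|.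

Definition relaxation_time M : R := (spectral_gap M)^-1.

Definition is_eigenvector M (l : R) v : Prop :=
  v != 0 /\ M *m v = l *: v.

(* The two proportions add up to 1, so (for n > 0) no entry vanishes. *)
Definition sign_proportions v (mu : R) : Prop :=
  #|[set i | v i 0 < 0]|%:R = mu * n%:R /\
  #|[set i | 0 < v i 0]|%:R = (1 - mu) * n%:R.

End Defs.

(* Main.v *)
(* With E the diagonal matrix of weighted degrees of the graph B = A + (alpha/n) J,
   J the all-ones matrix, the eigenvalues of P(alpha) are those of the symmetric
   pencil B v = l E v, so they obey Rayleigh-quotient bounds.  Moving alpha to
   beta changes both quadratic forms by a multiple of alpha - beta, so no
   eigenvalue has to be differentiated: an eigenvector w at alpha is a test vector
   at beta < alpha.  If l < 0, its quotient at beta is below l.  If l > 0, the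
   test vector is w made orthogonal to the constants for the weights at beta, and
   its quotient exceeds l as soon as l |w|^2 > (sum w)^2 / n.  The sign condition
   gives (sum w)^2 <= n max(mu, 1 - mu) |w|^2, and max(mu, 1 - mu) < 1 - gamma(P);
   as max(mu, 1 - mu) is one of finitely many fractions k/n, the slack is uniform,
   and lower semicontinuity at 0 gives max(mu, 1 - mu) < |l| for small alpha.
   Semicontinuity at b deals with the right endpoint, where no sign condition is
   assumed. *)
Require Import Defs.
From mathcomp Require Import all_boot all_order all_algebra.
From mathcomp Require Import boolp classical_sets reals.
From mathcomp Require Import ring lra.

Set Implicit Arguments.
Unset Strict Implicit.
Unset Printing Implicit Defensive.

Import Order.TTheory GRing.Theory Num.Theory.
Local Open Scope ring_scope.

(** * Algebra of the bilinear form of a matrix *)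

Section BilinearForm.
Variables (R : comNzRingType) (n : nat).
Implicit Types (M N : 'M[R]_n) (x y z : 'cV[R]_n) (k : R).

Definition mxform M x y : R := (x^T *m M *m y) 0 0.

Lemma mxformDl M x y z : mxform M (x + y) z = mxform M x z + mxform M y z.
Proof. by rewrite /mxform linearD /= !mulmxDl mxE. Qed.

Lemma mxformDr M x y z : mxform M x (y + z) = mxform M x y + mxform M x z.
Proof. by rewrite /mxform mulmxDr mxE. Qed.

Lemma mxformZl M k x y : mxform M (k *: x) y = k * mxform M x y.
Proof. by rewrite /mxform linearZ /= -!scalemxAl mxE. Qed.

Lemma mxformZr M k x y : mxform M x (k *: y) = k * mxform M x y.
Proof. by rewrite /mxform -scalemxAr mxE. Qed.

Lemma mxformD M N x y : mxform (M + N) x y = mxform M x y + mxform N x y.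
Proof. by rewrite /mxform mulmxDr mulmxDl mxE. Qed.

Lemma mxformZ M k x y : mxform (k *: M) x y = k * mxform M x y.
Proof. by rewrite /mxform -scalemxAr -scalemxAl mxE. Qed.

Lemma mxformN M x y : mxform (- M) x y = - mxform M x y.
Proof. by rewrite -scaleN1r mxformZ mulN1r. Qed.

Lemma mxform0l M y : mxform M 0 y = 0.
Proof. by rewrite -(scale0r 0) mxformZl mul0r. Qed.

Lemma mxformC M x y : M^T = M -> mxform M x y = mxform M y x.
Proof.
move=> sM; rewrite /mxform; transitivity ((x^T *m M *m y)^T 0 0).
  by rewrite [RHS]mxE.
by rewrite !trmx_mul trmxK sM mulmxA.
Qed.

Lemma mxform_mulmx M N x y : mxform M x (N *m y) = mxform (M *m N) x y.
Proof. by rewrite /mxform !mulmxA. Qed.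

Lemma mxformE M x y : mxform M x y = \sum_i \sum_j x i 0 * M i j * y j 0.
Proof.
rewrite /mxform mxE exchange_big /=; apply: eq_bigr => j _.
by rewrite mxE mulr_suml; apply: eq_bigr => i _; rewrite mxE.
Qed.

Lemma mxform1E x y : mxform 1%:M x y = \sum_i x i 0 * y i 0.
Proof. by rewrite /mxform mulmx1 mxE; apply: eq_bigr => i _; rewrite mxE. Qed.

End BilinearForm.

(** * Rayleigh quotients of symmetric pencils *)

Section Rayleigh.
Variables (R : realType) (n : nat).
Implicit Types (M N B E : 'M[R]_n) (x y v w : 'cV[R]_n) (r l t k : R).

Lemma mxform1_ge0 x : 0 <= mxform 1%:M x x.
Proof. by rewrite mxform1E sumr_ge0 // => i _; rewrite -expr2 sqr_ge0. Qed.

Lemma sqr_le_form1 x i : x i 0 ^+ 2 <= mxform 1%:M x x.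
Proof.
rewrite mxform1E (bigD1 i) //= -expr2 lerDl sumr_ge0 // => j _.
by rewrite -expr2 sqr_ge0.
Qed.

Lemma mxform1_gt0 x : x != 0 -> 0 < mxform 1%:M x x.
Proof.
move=> x0; rewrite lt0r mxform1_ge0 andbT; apply: contra_neq x0 => e.
apply/matrixP => i j; rewrite ord1 mxE; apply/eqP.
rewrite -sqrf_eq0; apply/eqP/le_anti; rewrite sqr_ge0 andbT.
by rewrite -e sqr_le_form1.
Qed.

Lemma mxform_bound M : 
  exists2 k, 0 < k & forall x, mxform M x x <= k * mxform 1%:M x x.
Proof.
exists (1 + \sum_i \sum_j `|M i j|).
  by rewrite ltr_pwDl // sumr_ge0 // => i _; rewrite sumr_ge0.
move=> x; rewrite mulrDl mul1r -[leLHS]add0r lerD ?mxform1_ge0 //.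
rewrite mxformE mulr_suml ler_sum // => i _; rewrite mulr_suml ler_sum // => j _.
rewrite mulrAC mulrC; apply: le_trans (ler_norm _) _; rewrite normrM.
apply: ler_wpM2l => //; rewrite ler_norml.
have := sqr_le_form1 x i; have := sqr_le_form1 x j.
have := sqr_ge0 (x i 0 + x j 0); have := sqr_ge0 (x i 0 - x j 0).
by move=> *; apply/andP; split; nra.
Qed.

(** The form at [x + k *: y] is a nonnegative quadratic in [k]. As [M] is only semidefinite, its
    leading coefficient may vanish. *)
Lemma mxform_cauchy_schwarz M x y : M^T = M -> (forall z, 0 <= mxform M z z) ->
  mxform M x y ^+ 2 <= mxform M x x * mxform M y y.
Proof.
move=> sM psd.
have key k : 0 <= mxform M x x + 2 * k * mxform M x y + k ^+ 2 * mxform M y y.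
  have := psd (x + k *: y).
  by rewrite mxformDl !mxformDr !mxformZl !mxformZr [mxform M y x]mxformC // => h; lra.
have [y0|y0] := eqVneq (mxform M y y) 0.
  rewrite y0 mulr0; have [->|xy0] := eqVneq (mxform M x y) 0; first by rewrite expr0n.
  (* The quadratic is now affine with nonzero slope; at this [k] it equals -1. *)
  have := key (- (mxform M x x + 1) / (2 * mxform M x y)); rewrite y0 mulr0 addr0.
  have -> : 2 * (- (mxform M x x + 1) / (2 * mxform M x y)) * mxform M x y
    = - (mxform M x x + 1) by field.
  lra.
have yy : 0 < mxform M y y by rewrite lt0r y0 psd.
(* The minimiser of the quadratic. *)
have := key (- mxform M x y / mxform M y y).
have -> : mxform M x x + 2 * (- mxform M x y / mxform M y y) * mxform M x y +
  (- mxform M x y / mxform M y y) ^+ 2 * mxform M y y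
  = (mxform M x x * mxform M y y - mxform M x y ^+ 2) / mxform M y y by field.
by rewrite pmulr_lge0 ?invr_gt0 // subr_ge0.
Qed.

Lemma singular_ker M : M^T = M -> M \notin unitmx -> exists2 v : 'cV[R]_n, v != 0 & M *m v = 0.
Proof.
move=> sM; rewrite -row_free_unit -kermx_eq0 => /rowV0Pn[u /sub_kermxP uM u0].
exists u^T; first by rewrite trmx_eq0.
by rewrite -sM -trmx_mul uM trmx0.
Qed.

(* Cauchy-Schwarz for the pair [x], [M^-1 x] turns invertibility into
   coercivity. *)
Lemma psd_unit_coercive M : M^T = M -> (forall z, 0 <= mxform M z z) ->
  M \in unitmx -> exists2 k, 0 < k & forall x, mxform 1%:M x x <= k * mxform M x x.
Proof.
move=> sM psd uM; have [k k0 hk] := mxform_bound (invmx M).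
exists k => // x; have [->|x0] := eqVneq x 0; first by rewrite !mxform0l mulr0.
have eMx : mxform M x (invmx M *m x) = mxform 1%:M x x.
  by rewrite mxform_mulmx mulmxV.
have eMM : mxform M (invmx M *m x) (invmx M *m x) = mxform (invmx M) x x.
  rewrite mxform_mulmx mulmxV // mxformC ?trmx1 // mxform_mulmx mul1mx //.
have := mxform_cauchy_schwarz x (invmx M *m x) sM psd.
rewrite eMx eMM expr2 => h.
have x1 := mxform1_gt0 x0; rewrite -(ler_pM2r x1).
apply: le_trans h _; rewrite [k * _]mulrC -mulrA.
exact: ler_wpM2l.
Qed.

(** Let [l] be the supremum of the quotients of [B] over [E]. Then [l *: E - B] is semidefinite; if
    it were invertible it would be coercive and [l] could be lowered. So it is singular, and a
    kernel vector is an eigenvector. *)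
Lemma rayleigh B E r x : B^T = B -> E^T = E ->
  (forall y, y != 0 -> 0 < mxform E y y) -> r * mxform E x x < mxform B x x ->
  exists l v, [/\ r < l, v != 0 & B *m v = l *: (E *m v)].
Proof.
move=> sB sE pE rx.
have x0 : x != 0 by apply: contraTneq rx => ->; rewrite !mxform0l mulr0 ltxx.
have uE : E \in unitmx.
  apply: contraT => /(singular_ker sE)[v v0 Ev].
  by have := pE v v0; rewrite -[v in mxform E v v]mul1mx mxform_mulmx /mxform mulmx1 -mulmxA Ev mulmx0 mxE ltxx.
have pE' y : 0 <= mxform E y y.
  by have [->|/pE/ltW//] := eqVneq y 0; rewrite mxform0l.
have [kE kE0 hE] := psd_unit_coercive sE pE' uE.
have [kB kB0 hB] := mxform_bound B.
have [k' k'0 hE'] := mxform_bound E.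
pose S : set R := [set t | exists2 y, y != 0 & t * mxform E y y <= mxform B y y]%classic.
have Sub : has_ubound S.
  exists (kB * kE) => t [y y0 hy]; rewrite -(ler_pM2r (pE y y0)).
  apply: le_trans hy _; apply: le_trans (hB y) _.
  by rewrite -mulrA ler_pM2l.
have Sx : S (mxform B x x / mxform E x x).
  by exists x => //; rewrite divfK ?gt_eqF ?pE.
pose l := sup S.
have rl : r < l.
  apply: lt_le_trans (ub_le_sup Sub Sx).
  by rewrite ltr_pdivlMr ?pE.
pose M := l *: E - B.
have sM : M^T = M by rewrite /M linearB linearZ /= sE sB.
have fM y : mxform M y y = l * mxform E y y - mxform B y y.
  by rewrite /M mxformD mxformN mxformZ.
have pM y : 0 <= mxform M y y.
  have [->|y0] := eqVneq y 0; first by rewrite mxform0l.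
  rewrite fM subr_ge0 -ler_pdivrMr ?pE //; apply: ub_le_sup => //.
  by exists y => //; rewrite divfK ?gt_eqF ?pE.
have [uM|/(singular_ker sM)[v v0 Mv]] := boolP (M \in unitmx); last first.
  exists l, v; split => //; apply/esym/eqP; rewrite -subr_eq0 scalemxAl.
  by rewrite -mulmxBl Mv.
have [kM kM0 hM] := psd_unit_coercive sM pM uM.
(* The form of [E] is at most [k' * kM] times that of [M], which pushes every quotient below [l] by
   a fixed amount. *)
have : l <= l - (k' * kM)^-1.
  apply: ge_sup; first by exists (mxform B x x / mxform E x x).
  move=> t [y y0 hy]; rewrite -(ler_pM2r (pE y y0)); apply: le_trans hy _.
  rewrite mulrBl lerBrDl -lerBrDr -fM.
  rewrite mulrC ler_pdivrMr ?mulr_gt0 //; apply: le_trans (hE' y) _.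
  by rewrite [mxform M y y * _]mulrC -mulrA ler_pM2l.
by rewrite lerBrDr gerDl invr_le0 leNgt mulr_gt0.
Qed.

End Rayleigh.

(** * Degrees, Laplacians and the pencil of a connected graph *)

Section Graph.
Variables (R : realType) (n : nat).
Implicit Types (A B M : 'M[R]_n) (x y v w : 'cV[R]_n) (r l t s : R).

Definition deg_mx B : 'M[R]_n := diag_mx (degree B)^T.

Lemma degreeE B i : degree B i 0 = \sum_j B i j.
Proof. by rewrite mxE; apply: eq_bigr => j _; rewrite mxE mulr1. Qed.

Lemma deg_mx_sym B : (deg_mx B)^T = deg_mx B.
Proof. exact: tr_diag_mx. Qed.

Lemma deg_mx_ones B : deg_mx B *m ones R n = degree B.
Proof.
by apply/matrixP => i j; rewrite ord1 mul_diag_mx !mxE mulr1.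
Qed.

Lemma deg_mx_formE B x y :
  mxform (deg_mx B) x y = \sum_i degree B i 0 * (x i 0 * y i 0).
Proof.
rewrite /mxform -mulmxA mxE; apply: eq_bigr => i _.
by rewrite mul_diag_mx !mxE; ring.
Qed.

Lemma deg_mx_pd B x : (forall i, 0 < degree B i 0) -> x != 0 ->
  0 < mxform (deg_mx B) x x.
Proof.
move=> dB x0; rewrite deg_mx_formE lt0r sumr_ge0 ?andbT; last first.
  by move=> i _; rewrite mulr_ge0 ?(ltW (dB i)) // -expr2 sqr_ge0.
apply: contra_neq x0 => /psumr_eq0P h.
apply/matrixP => i j; rewrite ord1 mxE.
have /eqP : degree B i 0 * (x i 0 * x i 0) = 0.
  by apply: h => // k _; rewrite mulr_ge0 ?(ltW (dB k)) // -expr2 sqr_ge0.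
by rewrite mulf_eq0 (gt_eqF (dB i)) /= mulf_eq0 orbb => /eqP.
Qed.

Lemma deg_mx_unit B : (forall i, 0 < degree B i 0) -> deg_mx B \in unitmx.
Proof.
move=> dB; rewrite unitmxE det_diag unitfE; apply/prodf_neq0 => i _.
by rewrite mxE gt_eqF ?dB.
Qed.

(* Both signs at once: [s = 1] gives the Laplacian, [s = -1] the signless one. *)
Lemma laplacian_form B s x : B^T = B -> s ^+ 2 = 1 ->
  2 * (mxform (deg_mx B) x x - s * mxform B x x) =
  \sum_i \sum_j B i j * (x i 0 - s * x j 0) ^+ 2.
Proof.
move=> sB s1.
have e1 : mxform (deg_mx B) x x = \sum_i \sum_j B i j * x i 0 ^+ 2.
  rewrite deg_mx_formE; apply: eq_bigr => i _.
  by rewrite degreeE mulr_suml; apply: eq_bigr => j _; rewrite expr2.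
have e2 : mxform (deg_mx B) x x = \sum_i \sum_j B i j * x j 0 ^+ 2.
  rewrite e1 exchange_big /=; apply: eq_bigr => j _; apply: eq_bigr => i _.
  by rewrite -{1}sB mxE.
have -> : 2 * (mxform (deg_mx B) x x - s * mxform B x x) =
  mxform (deg_mx B) x x + mxform (deg_mx B) x x - 2 * s * mxform B x x by ring.
rewrite {1}e1 e2 mxformE -big_split /= mulr_sumr -sumrB; apply: eq_bigr => i _.
rewrite -big_split /= mulr_sumr -sumrB; apply: eq_bigr => j _.
have -> : B i j * (x i 0 - s * x j 0) ^+ 2 =
  B i j * x i 0 ^+ 2 + s ^+ 2 * (B i j * x j 0 ^+ 2)
   - 2 * s * (x i 0 * B i j * x j 0) by ring.
by rewrite s1 mul1r.
Qed.

Lemma pencil_form B l v : B *m v = l *: (deg_mx B *m v) ->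
  mxform B v v = l * mxform (deg_mx B) v v.
Proof. by move=> e; rewrite /mxform -!mulmxA e -scalemxAr mxE. Qed.

(** The Laplacian form of sign [s] is nonnegative, and at [v] it is [1 - s * l] times the positive
    degree form. *)
Lemma pencil_le1 B s l v : connected_weighted_graph B ->
  (forall i, 0 < degree B i 0) -> v != 0 -> s ^+ 2 = 1 ->
  B *m v = l *: (deg_mx B *m v) -> s * l <= 1.
Proof.
move=> [sB B0 _] dB v0 s1 /pencil_form e.
have := laplacian_form v sB s1; rewrite e => h.
have {h} : 0 <= 2 * (mxform (deg_mx B) v v - s * (l * mxform (deg_mx B) v v)).
  by rewrite h sumr_ge0 // => i _; rewrite sumr_ge0 // => j _; rewrite mulr_ge0 ?sqr_ge0.
by have := deg_mx_pd dB v0; nra.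
Qed.

(** At the extreme eigenvalue the Laplacian form vanishes, hence so does each of its nonnegative
    edge terms. *)
Lemma pencil_eq1 B s v : connected_weighted_graph B -> s ^+ 2 = 1 ->
  B *m v = s *: (deg_mx B *m v) ->
  forall i j, 0 < B i j -> v i 0 = s * v j 0.
Proof.
move=> [sB B0 _] s1 /pencil_form e i j Bij.
have := laplacian_form v sB s1; rewrite e mulrA -expr2 s1 mul1r subrr mulr0.
move/esym/psumr_eq0P => h.
have {h} /psumr_eq0P h : \sum_j B i j * (v i 0 - s * v j 0) ^+ 2 = 0.
  by apply: h => // k _; rewrite sumr_ge0 // => m _; rewrite mulr_ge0 ?sqr_ge0.
have /eqP : B i j * (v i 0 - s * v j 0) ^+ 2 = 0.
  by apply: h => // k _; rewrite mulr_ge0 ?sqr_ge0.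
by rewrite mulf_eq0 gt_eqF //= sqrf_eq0 subr_eq0 => /eqP.
Qed.

Lemma pencil1_const B v : connected_weighted_graph B ->
  B *m v = deg_mx B *m v -> forall i j, v i 0 = v j 0.
Proof.
move=> hB e i j; have [_ _ cB] := hB.
have /connectP[p] := cB i j.
have {}e : B *m v = 1 *: (deg_mx B *m v) by rewrite scale1r.
elim: p i => [|k p IH] i /=; first by move=> _ ->.
case/andP => /(pencil_eq1 hB (expr1n _ _) e) -> /IH h /h ->.
by rewrite mul1r.
Qed.

(** A path from [i] to another vertex starts with a positive entry of row [i]. *)
Lemma degree_gt0 A i : connected_weighted_graph A -> (1 < n)%N ->
  0 < degree A i 0.
Proof.
move=> [_ A0 cA] n1.
have [j ji] : exists j, j != i.
  apply/existsP; apply: contraTT n1; rewrite negb_exists -leqNgt => /forallP h.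
  rewrite -[n]card_ord (eq_card (B := pred1 i)) ?card1 // => j.
  by have := h j; rewrite negbK => /eqP ->; rewrite !inE eqxx.
have /connectP[[|k p] /=] := cA i j; first by move=> _ e; rewrite e eqxx in ji.
case/andP=> Aik _ _; rewrite degreeE (bigD1 k) //= ltr_pwDl // sumr_ge0 //.
Qed.

(* Subtracting the rank-one part carried by the eigenvector [ones] of [1]
   replaces that eigenvalue by [0] and keeps the others. *)
Lemma pencil_second B r x : connected_weighted_graph B ->
  (forall i, 0 < degree B i 0) -> (0 < n)%N -> 0 <= r ->
  mxform (deg_mx B) (ones R n) x = 0 ->
  r * mxform (deg_mx B) x x < mxform B x x ->
  exists l v, [/\ r < l, l != 1, v != 0 & B *m v = l *: (deg_mx B *m v)].
Proof.
move=> hB dB n0 r0 x1 rx; have [sB _ _] := hB.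
have ones0 : ones R n != 0.
  apply/negP => /eqP/matrixP/(_ (Ordinal n0) 0); rewrite !mxE => /eqP.
  by rewrite oner_eq0.
set E := deg_mx B in x1 rx *.
have sE : E^T = E := deg_mx_sym B.
pose s := mxform E (ones R n) (ones R n).
have s0 : 0 < s by exact: deg_mx_pd.
pose Q := degree B *m (degree B)^T.
have fQ y z : mxform Q y z = mxform E (ones R n) y * mxform E (ones R n) z.
  rewrite /mxform.
  have -> : y^T *m Q *m z = (y^T *m degree B) *m ((degree B)^T *m z).
    by rewrite /Q !mulmxA.
  rewrite mxE big_ord1 -deg_mx_ones -/E trmx_mul sE mulmxA; congr (_ * _).
  exact: mxformC.
have Qv v : mxform E (ones R n) v = 0 -> Q *m v = 0.
  move=> h; rewrite /Q -mulmxA -deg_mx_ones -/E trmx_mul sE.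
  have -> : (ones R n)^T *m E *m v = 0.
    by apply/matrixP => i j; rewrite !ord1 [LHS]h mxE.
  by rewrite mulmx0.
have Bones v : mxform B (ones R n) v = mxform E (ones R n) v.
  rewrite [LHS]mxformC // [RHS]mxformC // /mxform -!mulmxA deg_mx_ones //.
pose B' := B - s^-1 *: Q.
have sB' : B'^T = B' by rewrite /B' linearB linearZ /= sB trmx_mul trmxK.
have fB' y z : mxform B' y z = mxform B y z - s^-1 * mxform Q y z.
  by rewrite /B' mxformD mxformN mxformZ.
have rx' : r * mxform E x x < mxform B' x x by rewrite fB' fQ x1 !mulr0 subr0.
have [l [v [rl v0 Bv]]] := rayleigh sB' sE (fun y => deg_mx_pd dB) rx'.
have l0 : 0 < l by apply: le_lt_trans rl.
(* [ones] is in the kernel of [B'], so an eigenvector for [l > 0] is orthogonal to it; then [Q]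
   kills [v], and [v] is an eigenvector for [B] too. *)
have ev : mxform E (ones R n) v = 0.
  have : mxform B' (ones R n) v = l * mxform E (ones R n) v.
    by rewrite /mxform -!mulmxA Bv -scalemxAr mxE.
  rewrite fB' fQ Bones -/s mulKf ?gt_eqF // subrr => /esym/eqP.
  by rewrite mulf_eq0 gt_eqF //= => /eqP.
have Bv' : B *m v = l *: (E *m v).
  by rewrite -Bv /B' mulmxBl -scalemxAl Qv // scaler0 subr0.
(* For [l = 1] the vector would be constant as well as orthogonal to the constants. *)
exists l, v; split => //; apply: contraNneq v0 => l1.
rewrite l1 scale1r in Bv'.
have cv := pencil1_const hB Bv'.
have vE : v = v (Ordinal n0) 0 *: ones R n.
  by apply/matrixP => i j; rewrite ord1 !mxE mulr1; apply: cv.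
move: ev; rewrite vE mxformZr -/s => /eqP; rewrite mulf_eq0 [s == 0]gt_eqF // orbF.
by move=> /eqP ->; rewrite scale0r.
Qed.

Lemma pencil_neg B r x : B^T = B -> (forall i, 0 < degree B i 0) ->
  mxform B x x < - r * mxform (deg_mx B) x x ->
  exists l v, [/\ l < - r, v != 0 & B *m v = l *: (deg_mx B *m v)].
Proof.
move=> sB dB rx.
have sB' : (- B)^T = - B by rewrite linearN /= sB.
have rx' : r * mxform (deg_mx B) x x < mxform (- B) x x.
  by rewrite mxformN ltrNr -mulNr.
have [l [v [rl v0 Bv]]] := rayleigh sB' (deg_mx_sym B) (fun y => deg_mx_pd dB) rx'.
exists (- l), v; split => //; first by rewrite ltrN2.
by rewrite scaleNr -Bv mulNmx opprK.
Qed.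

End Graph.

(** * The walk with jumps as an ordinary walk on a modified graph *)

Section JumpGraph.
Variables (R : realType) (n : nat) (A : 'M[R]_n).
Hypotheses (hA : connected_weighted_graph A) (n1 : (1 < n)%N).
Implicit Types (x y v w : 'cV[R]_n) (r l t s h alpha beta : R).

Let n0 : (0 < n)%N := ltnW n1.
Let nR0 : 0 < n%:R :> R. Proof. by rewrite ltr0n. Qed.

Let sqrN1 : (-1) ^+ 2 = 1 :> R. Proof. by rewrite sqrrN expr1n. Qed.

Definition jump alpha : 'M[R]_n := A + (alpha / n%:R) *: (ones R n *m (ones R n)^T).

Local Notation E alpha := (deg_mx (jump alpha)).
Local Notation sum x := (mxform 1%:M (ones R n) x).
Local Notation nrm2 x := (mxform 1%:M x x).

Lemma jumpE alpha i j : jump alpha i j = A i j + alpha / n%:R.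
Proof. by rewrite !mxE big_ord1 !mxE !mulr1. Qed.

Lemma jump_graph alpha : 0 <= alpha -> connected_weighted_graph (jump alpha).
Proof.
move=> a0; have [sA A0 cA] := hA.
have c0 : 0 <= alpha / n%:R by rewrite divr_ge0 ?ler0n.
split.
- by rewrite /jump linearD linearZ /= sA trmx_mul trmxK.
- by move=> i j; rewrite jumpE addr_ge0.
- move=> i j; apply: connect_sub (cA i j) => k l /= Akl.
  by rewrite connect1 //= jumpE ltr_wpDr.
Qed.

(** Each row of the rank-one part sums to [alpha], so the matrix inverted in [jump_walk] is the
    degree matrix of [jump alpha]. *)
Lemma deg_jump alpha : E alpha = (diag_mx (degree A)^T + alpha%:M).
Proof.
have dj : degree (jump alpha) = degree A + alpha *: ones R n.
  apply/matrixP => i j; rewrite ord1 degreeE [RHS]mxE degreeE !mxE mulr1.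
  under eq_bigr => k _ do rewrite jumpE.
  by rewrite big_split /= sumr_const card_ord -[_ / _ *+ n]mulr_natr divfK ?gt_eqF.
by apply/matrixP => i j; rewrite /deg_mx dj !mxE mulr1 mulrnDl.
Qed.

Lemma jump_degree_gt0 alpha i : 0 <= alpha -> 0 < degree (jump alpha) i 0.
Proof. by move=> /jump_graph hB; apply: degree_gt0. Qed.

Lemma jump_walkE alpha : jump_walk A alpha = invmx (E alpha) *m jump alpha.
Proof. by rewrite deg_jump. Qed.

Lemma jump_walk_eigenvector alpha l v : 0 <= alpha ->
  jump_walk A alpha *m v = l *: v -> jump alpha *m v = l *: (E alpha *m v).
Proof.
move=> a0; rewrite jump_walkE -mulmxA => e.
have uE : E alpha \in unitmx by apply: deg_mx_unit => i; apply: jump_degree_gt0.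
by rewrite scalemxAr -e mulKVmx.
Qed.

(** Both matrices being symmetric, row eigenvectors [u] of the walk match column solutions [v] of
    the pencil through [u = (E alpha *m v)^T]. *)
Lemma jump_walk_eigenvalueP alpha l : 0 <= alpha ->
  eigenvalue (jump_walk A alpha) l <->
  exists2 v : 'cV[R]_n, v != 0 & jump alpha *m v = l *: (E alpha *m v).
Proof.
move=> a0.
have uE : E alpha \in unitmx by apply: deg_mx_unit => i; apply: jump_degree_gt0.
have [sB _ _] := jump_graph a0; have sE := deg_mx_sym (jump alpha).
rewrite jump_walkE; split.
- move=> /eigenvalueP[u eu u0]; exists (u *m invmx (E alpha))^T.
    rewrite trmx_eq0; apply: contra_neq u0 => h.
    by rewrite -[u](mulmxKV uE) h mul0mx.
  apply: trmx_inj; rewrite linearZ /= !trmx_mul !trmxK sB sE.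
  by rewrite mulmxKV // -mulmxA.
- move=> [v v0 ev]; apply/eigenvalueP; exists (E alpha *m v)^T.
    rewrite trmx_mul sE mulmxA mulmxK // -[in LHS]sB -trmx_mul ev linearZ /=.
    by rewrite trmx_mul sE.
  rewrite trmx_eq0; apply: contra_neq v0 => h.
  by rewrite -[v](mulKmx uE) h mulmx0.
Qed.

Lemma jump_walk_eigenvalue_lt1 alpha l : 0 <= alpha ->
  eigenvalue (jump_walk A alpha) l -> l != 1 -> l != -1 -> `|l| < 1.
Proof.
move=> a0 /(jump_walk_eigenvalueP _ a0)[v v0 e] l1 lN1.
have hB := jump_graph a0.
have dB i : 0 < degree (jump alpha) i 0 := jump_degree_gt0 i a0.
have h1 := pencil_le1 hB dB v0 (expr1n _ 2) e.
have h2 := pencil_le1 hB dB v0 sqrN1 e.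
rewrite ltr_norml !lt_neqAle l1 eq_sym lN1 /=; apply/andP; split; lra.
Qed.

(** Jumps give every vertex a self-loop, where an eigenvector for -1 must satisfy
    [v i 0 = - v i 0]. *)
Lemma jump_walk_eigenvalueN1 alpha : 0 < alpha ->
  ~~ eigenvalue (jump_walk A alpha) (-1).
Proof.
move=> a0; apply/negP => /(jump_walk_eigenvalueP _ (ltW a0))[v v0].
move=> /(pencil_eq1 (jump_graph (ltW a0)) sqrN1) h; case/negP: v0.
apply/eqP/matrixP => i j; rewrite ord1 mxE.
have [_ A0 _] := hA.
have /h : 0 < jump alpha i i by rewrite jumpE ltr_wpDl // divr_gt0.
lra.
Qed.

Lemma jump_form alpha beta x y : mxform (jump beta) x y =
  mxform (jump alpha) x y - (alpha - beta) / n%:R * (sum x * sum y).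
Proof.
have fJ : mxform (ones R n *m (ones R n)^T) x y = sum x * sum y.
  rewrite [sum x]mxformC ?trmx1 // /mxform !mulmx1 mulmxA -mulmxA.
  by rewrite mxE big_ord1.
by rewrite /jump !mxformD !mxformZ fJ; ring.
Qed.

Lemma deg_jump_form alpha beta x y : mxform (E beta) x y =
  mxform (E alpha) x y - (alpha - beta) * mxform 1%:M x y.
Proof. by rewrite !deg_jump !mxformD -[beta%:M]scalemx1 -[alpha%:M]scalemx1 !mxformZ; ring. Qed.

Lemma deg_jump_ones alpha : jump alpha *m ones R n = E alpha *m ones R n.
Proof. by rewrite deg_mx_ones. Qed.

Lemma jump_ones_form alpha x : 0 <= alpha ->
  mxform (jump alpha) (ones R n) x = mxform (E alpha) (ones R n) x.
Proof.
move=> a0; have [sB _ _] := jump_graph a0.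
rewrite mxformC // [RHS]mxformC ?deg_mx_sym //.
by rewrite /mxform -!mulmxA deg_jump_ones.
Qed.

(** [ones] is an eigenvector for 1, and eigenvectors of a symmetric pencil for distinct eigenvalues
    are orthogonal for the weights. *)
Lemma eigenvector_orth_ones alpha t w : 0 <= alpha -> t != 1 ->
  jump alpha *m w = t *: (E alpha *m w) -> mxform (E alpha) (ones R n) w = 0.
Proof.
move=> a0 t1 e; have := jump_ones_form w a0.
rewrite {1}/mxform -mulmxA e -scalemxAr mxE mulmxA -/(mxform _ _ _).
move/eqP; rewrite -subr_eq0 -{2}[mxform _ _ _]mul1r -mulrBl mulf_eq0.
by rewrite subr_eq0 (negbTE t1) => /eqP.
Qed.

(* [w] is made orthogonal to [ones] for the weights at [beta] by subtracting a
   multiple of [ones]; the condition says that the resulting vector has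
   Rayleigh quotient above [r]. *)
Lemma jump_second alpha beta r t w : 0 <= alpha -> 0 <= beta -> 0 <= r ->
  t != 1 -> jump alpha *m w = t *: (E alpha *m w) ->
  (1 - r) * (alpha - beta) ^+ 2 * sum w ^+ 2 <
    mxform (E beta) (ones R n) (ones R n) *
    ((t - r) * mxform (E alpha) w w
      + (alpha - beta) * (r * nrm2 w - sum w ^+ 2 / n%:R)) ->
  exists l, [/\ r < l, l != 1 & eigenvalue (jump_walk A beta) l].
Proof.
move=> a0 b0 r0 t1 e; set h := alpha - beta; set s := sum w.
set S := mxform (E beta) _ _; set q := mxform (E alpha) w w => H.
have dB i : 0 < degree (jump beta) i 0 := jump_degree_gt0 i b0.
have hB := jump_graph b0; have [sB _ _] := hB.
have ones0 : ones R n != 0.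
  apply/negP => /eqP/matrixP/(_ (Ordinal n0) 0); rewrite !mxE => /eqP.
  by rewrite oner_eq0.
have S0 : 0 < S by apply: deg_mx_pd.
have E1w : mxform (E beta) (ones R n) w = - (h * s).
  by rewrite (deg_jump_form alpha) (eigenvector_orth_ones a0 t1 e) sub0r.
have Ew1 : mxform (E beta) w (ones R n) = - (h * s).
  by rewrite mxformC ?deg_mx_sym.
have Eww : mxform (E beta) w w = q - h * nrm2 w by rewrite (deg_jump_form alpha).
have Bww : mxform (jump beta) w w = t * q - h / n%:R * s ^+ 2.
  by rewrite (jump_form alpha) (pencil_form e) -/q expr2.
have B1w : mxform (jump beta) (ones R n) w = - (h * s) by rewrite jump_ones_form.
have Bw1 : mxform (jump beta) w (ones R n) = - (h * s) by rewrite mxformC.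
have B11 : mxform (jump beta) (ones R n) (ones R n) = S by rewrite jump_ones_form.
(* Cancels [E1w] against [c * S]. *)
pose c := (h * s) / S.
pose x := w + c *: ones R n.
have x1 : mxform (E beta) (ones R n) x = 0.
  by rewrite /x mxformDr mxformZr E1w -/S /c divfK ?gt_eqF // addNr.
have rx : r * mxform (E beta) x x < mxform (jump beta) x x.
  rewrite -subr_gt0.
  (* The numerator over [S] is the difference of the two sides of [H]. *)
  suff -> : mxform (jump beta) x x - r * mxform (E beta) x x =
    (S * ((t - r) * q + h * (r * nrm2 w - s ^+ 2 / n%:R))
      - (1 - r) * h ^+ 2 * s ^+ 2) / S.
    by rewrite divr_gt0 // subr_gt0.
  rewrite /x !(mxformDl, mxformDr, mxformZl, mxformZr).
  rewrite Eww E1w Ew1 Bww B1w Bw1 B11 -/S /c.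
  field.
  by rewrite !gt_eqF.
have [l [v [rl l1 v0 Bv]]] := pencil_second hB dB n0 r0 x1 rx.
by exists l; split => //; apply/(jump_walk_eigenvalueP _ b0); exists v.
Qed.

(** At the bottom of the spectrum [ones] is no obstacle, so [w] itself is the test vector. The
    hypothesis is its quotient inequality at [beta], expanded around [alpha]. *)
Lemma jump_neg alpha beta r s w : 0 <= alpha -> 0 <= beta ->
  jump alpha *m w = - s *: (E alpha *m w) ->
  (r - s) * mxform (E alpha) w w
    - (alpha - beta) * (sum w ^+ 2 / n%:R + r * nrm2 w) < 0 ->
  exists2 l, l < - r & eigenvalue (jump_walk A beta) l.
Proof.
move=> a0 b0 e H.
have dB i : 0 < degree (jump beta) i 0 := jump_degree_gt0 i b0.
have [sB _ _] := jump_graph b0.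
have rx : mxform (jump beta) w w < - r * mxform (E beta) w w.
  rewrite (jump_form alpha) (deg_jump_form alpha beta) (pencil_form e).
  by rewrite -subr_lt0; apply: le_lt_trans H; rewrite le_eqVlt; apply/orP; left; apply/eqP; ring.
have [l [v [rl v0 Bv]]] := pencil_neg sB dB rx.
by exists l => //; apply/(jump_walk_eigenvalueP _ b0); exists v.
Qed.

End JumpGraph.

(** * Eigenvalues of maximal modulus, and sign counts *)

Section LambdaStar.
Variables (R : realType) (n : nat).
Implicit Types (M : 'M[R]_n) (v : 'cV[R]_n) (l mu : R).

(** Used on the characteristic polynomial, so that a largest modulus can be taken over a finite
    type. Linear factors are split off by induction on the size. *)
Lemma poly_roots_seq (p : {poly R}) : p != 0 ->
  exists s : seq R, forall x, root p x -> x \in s.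
Proof.
have [k] := ubnP (size p); elim: k p => // k IH p; rewrite ltnS => sp p0.
have [[x px]|npx] := pselect (exists x, root p x); last first.
  by exists [::] => x px; case: npx; exists x.
have /factor_theorem[q pq] := px.
have q0 : q != 0 by apply: contra_neq p0; rewrite pq => ->; rewrite mul0r.
have [|s hs] := IH q _ q0.
  by move: sp; rewrite pq size_Mmonic ?monicXsubC // size_XsubC addn2.
exists (x :: s) => y; rewrite pq rootM root_XsubC inE => /orP[/hs ->|->//].
by rewrite orbT.
Qed.

Lemma lambda_star_exists M l : eigenvalue M l -> l != 1 -> l != -1 ->
  exists2 l', is_lambda_star M l' & `|l| <= `|l'|.
Proof.
move=> el l1 lN1.
have [s hs] := poly_roots_seq (monic_neq0 (char_poly_monic M)).
have {}hs x : eigenvalue M x -> x \in s by rewrite eigenvalue_root_char; apply: hs.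
pose Q (i : seq_sub s) := [&& eigenvalue M (val i), val i != 1 & val i != -1].
pose i0 := SeqSub (hs _ el).
have Qi0 : Q i0 by rewrite /Q /= el l1 lN1.
have [i /and3P[ei i1 iN1] hi] := @arg_maxP _ R _ i0 Q (fun i => `|val i|) Qi0.
exists (val i); last exact: (hi i0 Qi0).
split => // x ex x1 xN1; have Qx : Q (SeqSub (hs _ ex)) by rewrite /Q /= ex x1.
exact: (hi _ Qx).
Qed.

Lemma spectral_gapP M : spectral_gap M = 1 \/
  exists2 l, is_lambda_star M l & spectral_gap M = 1 - `|l|.
Proof.
rewrite /spectral_gap; case: xgetP => [l _ hl|_]; first by right; exists l.
(* No candidate exists: [xget] returns its default 0. *)
by left; rewrite normr0 subr0.
Qed.

Lemma lambda_star_gap M l : is_lambda_star M l -> spectral_gap M = 1 - `|l|.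
Proof.
move=> [el l1 lN1 hl]; rewrite /spectral_gap; case: xgetP => [l' _|]; last first.
  by move=> /(_ l) [].
by move=> [el' l'1 l'N1 hl']; congr (1 - _); apply: le_anti; rewrite hl ?hl'.
Qed.

(** Cauchy-Schwarz against the indicator vector of [S]. *)
Lemma sum_sub_sqr v (S : {set 'I_n}) :
  (\sum_(i in S) v i 0) ^+ 2 <= #|S|%:R * mxform 1%:M v v.
Proof.
pose u : 'cV[R]_n := \col_i (i \in S)%:R.
have := mxform_cauchy_schwarz u v (@trmx1 _ n) (@mxform1_ge0 _ n).
have -> : mxform 1%:M u v = \sum_(i in S) v i 0.
  rewrite mxform1E [RHS]big_mkcond; apply: eq_bigr => i _; rewrite mxE.
  by case: ifP; rewrite ?mul1r ?mul0r.
have -> // : mxform 1%:M u u = #|S|%:R.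
rewrite mxform1E -sum1_card natr_sum [RHS]big_mkcond; apply: eq_bigr => i _.
by rewrite mxE; case: ifP; rewrite ?mul1r ?mul0r.
Qed.

(** The sum lies between the sum of the negative entries and that of the positive ones; according to
    its sign, one of them dominates it in modulus, and [sum_sub_sqr] bounds that one. *)
Lemma sign_proportions_sum v mu : sign_proportions v mu ->
  mxform 1%:M (ones R n) v ^+ 2 <=
  Num.max mu (1 - mu) * n%:R * mxform 1%:M v v.
Proof.
set neg := [set i | v i 0 < 0]%SET; set pos := [set i | 0 < v i 0]%SET.
move=> [eneg epos]; rewrite mxform1E.
under eq_bigr => i _ do rewrite mxE mul1r.
have N0 := mxform1_ge0 v.
have hp : \sum_i v i 0 <= \sum_(i in pos) v i 0.
  rewrite [leRHS]big_mkcond; apply: ler_sum => i _; rewrite inE.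
  by case: ltP.
have hn : \sum_(i in neg) v i 0 <= \sum_i v i 0.
  rewrite [leLHS]big_mkcond; apply: ler_sum => i _; rewrite inE.
  by case: ltP.
have := sum_sub_sqr v pos; rewrite epos => qp.
have := sum_sub_sqr v neg; rewrite eneg => qn.
have mp : (1 - mu) * n%:R * mxform 1%:M v v <=
    Num.max mu (1 - mu) * n%:R * mxform 1%:M v v.
  by rewrite !ler_wpM2r ?ler0n // le_max lexx orbT.
have mn : mu * n%:R * mxform 1%:M v v <=
    Num.max mu (1 - mu) * n%:R * mxform 1%:M v v.
  by rewrite !ler_wpM2r ?ler0n // le_max lexx.
have [s0|/ltW s0] := leP 0 (\sum_i v i 0).
  by apply: le_trans mp; apply: le_trans qp; nra.
by apply: le_trans mn; apply: le_trans qn; nra.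
Qed.

Lemma sign_proportions_nat v mu : (0 < n)%N -> sign_proportions v mu ->
  exists i : 'I_n.+1, Num.max mu (1 - mu) = i%:R / n%:R.
Proof.
move=> n0 [eneg epos].
have nR : n%:R != 0 :> R by rewrite pnatr_eq0 -lt0n.
have card_le (S : {set 'I_n}) : (#|S| < n.+1)%N.
  by rewrite ltnS -[leqRHS]card_ord max_card.
have [_|_] := leP mu (1 - mu).
- by exists (Ordinal (card_le [set i | 0 < v i 0]%SET)); rewrite /= epos mulfK.
- by exists (Ordinal (card_le [set i | v i 0 < 0]%SET)); rewrite /= eneg mulfK.
Qed.

(** [d] is the distance from [L] to the largest such fraction below it; as it depends only on [n]
    and [L], the slack is uniform in the jump rate. Positivity of [L] makes 0 a candidate. *)
Lemma nat_ratio_gap (L : R) : 0 < L -> exists2 d, 0 < d &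
  forall i : 'I_n.+1, i%:R / n%:R < L -> i%:R / n%:R + d <= L.
Proof.
move=> L0; pose Q (i : 'I_n.+1) := i%:R / n%:R < L :> R.
have Q0 : Q ord0 by rewrite /Q mul0r.
have [i Qi hi] := @arg_maxP _ R _ ord0 Q (fun i => i%:R / n%:R) Q0.
exists (L - i%:R / n%:R); first by rewrite subr_gt0.
by move=> j /hi /= hj; lra.
Qed.

End LambdaStar.

(** * Comparison of eigenvalues at two jump rates *)

Section Monotonicity.
Variables (R : realType) (n : nat) (A : 'M[R]_n).
Hypotheses (hA : connected_weighted_graph A) (n1 : (1 < n)%N).
Implicit Types (x y v w : 'cV[R]_n) (r l t s h alpha beta : R).

Let n0 : (0 < n)%N := ltnW n1.
Let nR0 : 0 < n%:R :> R. Proof. by rewrite ltr0n. Qed.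

Local Notation jump := (jump A).
Local Notation E alpha := (deg_mx (jump alpha)).
Local Notation sum x := (mxform 1%:M (ones R n) x).
Local Notation nrm2 x := (mxform 1%:M x x).
Local Notation vol := (mxform (E 0) (ones R n) (ones R n)).

Lemma vol_gt0 : 0 < vol.
Proof.
apply: deg_mx_pd => [i|]; first exact: jump_degree_gt0.
apply/negP => /eqP/matrixP/(_ (Ordinal n0) 0); rewrite !mxE => /eqP.
by rewrite oner_eq0.
Qed.

Lemma vol_le beta : 0 <= beta -> vol <= mxform (E beta) (ones R n) (ones R n).
Proof.
move=> b0; rewrite (deg_jump_form A n1 0 beta) sub0r mulNr opprK lerDl.
by rewrite mulr_ge0 ?mxform1_ge0.
Qed.

(** In [jump_second] and [jump_neg] the main term, a positive multiple of [|t| - r], does not depend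
    on [beta], while the errors are of order [|alpha - beta|]. The eigenvalue found may be -1;
    callers exclude that separately. *)
Lemma eigenvalue_lsc alpha r t : 0 <= alpha -> 0 <= r -> r < `|t| -> `|t| < 1 ->
  eigenvalue (jump_walk A alpha) t ->
  exists2 eta, 0 < eta & forall beta, 0 <= beta -> `|alpha - beta| < eta ->
    exists l, [/\ r < `|l|, l != 1 & eigenvalue (jump_walk A beta) l].
Proof.
move=> a0 r0 rt t1 /(jump_walk_eigenvalueP hA n1 _ a0)[w w0 ew].
have q0 : 0 < mxform (E alpha) w w.
  by apply: deg_mx_pd => // i; apply: jump_degree_gt0.
set q := mxform (E alpha) w w in q0.
have N0 := mxform1_ge0 w; have V0 := vol_gt0.
have s0 : 0 <= sum w ^+ 2 by rewrite sqr_ge0.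
have s1 : 0 <= sum w ^+ 2 / n%:R by rewrite divr_ge0 // ltW.
set V := vol in V0; set N := nrm2 w in N0; set s := sum w ^+ 2 in s0 s1.
set s' := s / n%:R in s1.
have [tp|tn] := ltP 0 t.
- rewrite gtr0_norm // in rt t1.
  pose K := s + V * (N + s') + 1.
  have K0 : 0 < K by rewrite /K; nra.
  have C0 : 0 < V * ((t - r) * q) by rewrite !mulr_gt0 ?subr_gt0.
  (* The bound 1 turns squares of the increment into first-order terms; all errors are then at most
     [K] times its modulus. *)
  exists (Num.min 1 (V * ((t - r) * q) / K)); first by rewrite lt_min ltr01 divr_gt0.
  move=> beta b0; rewrite lt_min ltr_pdivlMr // => /andP[h1 hK].
  have [|l [rl l1 el]] := jump_second hA n1 a0 b0 r0 (negbT (lt_eqF t1)) ew.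
    have hn := normr_ge0 (alpha - beta).
    rewrite -[(alpha - beta) ^+ 2]real_normK ?num_real //.
    have hl : - `|alpha - beta| <= alpha - beta by rewrite lerNl -normrN ler_norm.
    have hr := ler_norm (alpha - beta).
    rewrite -/q -/N -/s -/s'.
    set h := alpha - beta in hl hr *; set a := `|h| in h1 hK hn hl hr *.
    have hG : (t - r) * q - a * (N + s') <= (t - r) * q + h * (r * N - s').
      have f1 : 0 <= (a - h) * s' by rewrite mulr_ge0 ?subr_ge0.
      have f2 : 0 <= (h + a) * (r * N) by rewrite !mulr_ge0 // -lerBlDr sub0r.
      have f3 : 0 <= a * ((1 - r) * N).
        by rewrite !mulr_ge0 // subr_ge0 ltW // (lt_trans rt).
      by lra.
    have as0 : 0 <= a * s by rewrite mulr_ge0.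
    have hG0 : 0 < (t - r) * q - a * (N + s').
      by rewrite -(pmulr_rgt0 _ V0); rewrite /K in hK; lra.
    apply: (@lt_le_trans _ _ (V * ((t - r) * q - a * (N + s')))).
      rewrite /K in hK.
      have a2 : a ^+ 2 <= a by nra.
      have : (1 - r) * a ^+ 2 * s <= a * s.
        apply: ler_wpM2r => //; nra.
      by nra.
    apply: ler_pM => //; [exact: ltW|exact: ltW|exact: vol_le].
  by exists l; split => //; apply: lt_le_trans rl (ler_norm _).
- rewrite ler0_norm // in rt t1.
  pose K := s' + r * N + 1.
  have K0 : 0 < K by rewrite /K; nra.
  have C0 : 0 < (- t - r) * q by rewrite mulr_gt0 ?subr_gt0.
  exists ((- t - r) * q / K); first by rewrite divr_gt0.
  move=> beta b0; rewrite ltr_pdivlMr // => hK.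
  have ew' : jump alpha *m w = - (- t) *: (E alpha *m w) by rewrite opprK.
  have [|l rl el] := @jump_neg _ _ _ hA n1 alpha beta r (- t) w a0 b0 ew'.
    rewrite -/q -/N -/s -/s'.
    have hl : - `|alpha - beta| <= alpha - beta by rewrite lerNl -normrN ler_norm.
    have hn := normr_ge0 (alpha - beta).
    have f1 : 0 <= (alpha - beta + `|alpha - beta|) * (s' + r * N).
      apply: mulr_ge0; first by rewrite -lerBlDr sub0r.
      by apply: addr_ge0 => //; apply: mulr_ge0.
    by rewrite /K in hK; lra.
  have l0 : l < 0 by lra.
  exists l; split => //; last by rewrite lt_eqF //; lra.
  by rewrite ltr0_norm //; lra.
Qed.

(** Taking [r] to be the modulus of [t] removes the zeroth-order term. For [t > 0] the first-order
    gain, controlled by [d], must beat the quadratic cost of making [w] orthogonal to the constants;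
    the last hypothesis ensures it. *)
Lemma eigenvalue_decr alpha beta t m d w : 0 <= beta -> beta < alpha ->
  `|t| < 1 -> t != 0 -> w != 0 ->
  jump_walk A alpha *m w = t *: w ->
  0 < d -> m <= 1 -> sum w ^+ 2 <= m * n%:R * nrm2 w -> m + d <= `|t| ->
  (alpha - beta) * n%:R < vol * d ->
  exists l, [/\ `|t| < `|l|, l != 1 & eigenvalue (jump_walk A beta) l].
Proof.
move=> b0 ba t1 tn0 w0 ew d0 m1 sw mt hd.
have a0 : 0 <= alpha by apply: le_trans b0 (ltW ba).
have h0 : 0 < alpha - beta by rewrite subr_gt0.
have {}ew := jump_walk_eigenvector hA n1 a0 ew.
have N0 := mxform1_gt0 w0; have V0 := vol_gt0; have s0 := sqr_ge0 (sum w).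
have hn := nR0.
have [tp|tn] := ltP 0 t.
- rewrite gtr0_norm // in mt t1 *.
  have [|l [rl l1 el]] := jump_second hA n1 a0 b0 (ltW tp) (negbT (lt_eqF t1)) ew.
    rewrite subrr mul0r add0r.
    have sn : sum w ^+ 2 / n%:R <= m * nrm2 w.
      by rewrite ler_pdivrMr // mulrAC.
    have hV := vol_le b0.
    move: sn sw hV hd V0 N0 s0 hn h0.
    set V := vol; set V' := mxform (E beta) _ _; set N := nrm2 w.
    set s' := sum w ^+ 2 / n%:R; set s := sum w ^+ 2; set nn := n%:R.
    set h := alpha - beta => sn sw hV hd V0 N0 s0 hn h0.
    (* The first-order gain per unit of [h]. *)
    have g : d * N <= t * N - s' by nra.
    have e1 : h * s <= h * nn * N.
      have : s <= nn * N.
        by apply: le_trans sw _; rewrite -mulrA ler_piMl // mulr_ge0 // ltW.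
      by rewrite -mulrA ler_pM2l.
    have e2 : h * nn * N < V * d * N by rewrite ltr_pM2r.
    have e3 : V * (d * N) <= V' * (t * N - s').
      by apply: ler_pM => //; [exact: ltW|rewrite mulr_ge0 // ltW].
    have e4 : (1 - t) * (h * s) <= h * s.
      by apply: ler_piMl; [rewrite mulr_ge0 // ltW | lra].
    have : h * ((1 - t) * (h * s)) < h * (V' * (t * N - s')).
      by rewrite ltr_pM2l //; lra.
    by move=> H; lra.
  by exists l; split => //; apply: lt_le_trans rl (ler_norm _).
- rewrite ler0_norm // in mt t1 *.
  have tl : t < 0 by rewrite lt_neqAle tn0.
  have ew' : jump alpha *m w = - (- t) *: (E alpha *m w) by rewrite opprK.
  have [|l rl el] := @jump_neg _ _ _ hA n1 alpha beta (- t) (- t) w a0 b0 ew'.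
    have s1 : 0 <= sum w ^+ 2 / n%:R by rewrite divr_ge0 // ltW.
    (* For [t < 0] both first-order terms have the favourable sign. *)
    rewrite subrr mul0r sub0r oppr_lt0 mulr_gt0 //; nra.
  have l0 : l < 0 by lra.
  exists l; split => //; last by rewrite lt_eqF //; lra.
  by rewrite ltr0_norm //; lra.
Qed.

End Monotonicity.

(** * Degenerate orders, and decrease of the relaxation time *)

Lemma jump_walk_order_le1 (R : realType) (n : nat) (A : 'M[R]_n) (alpha l : R)
    (v : 'cV[R]_n) :
  (n <= 1)%N -> (forall i j, 0 <= A i j) -> 0 < alpha ->
  is_eigenvector (jump_walk A alpha) l v -> l = 1.
Proof.
case: n A v => [|[|//]] A v _ A0 a0 [v0 ev].
  by case/eqP: v0; apply/matrixP => -[].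
(* In order 1 both factors of the walk come from the same scalar, so the walk is the identity. *)
have EB : diag_mx (degree A)^T + alpha%:M =
    A + (alpha / 1%:R) *: (ones R 1 *m (ones R 1)^T).
  apply/matrixP => i j; rewrite !ord1 !mxE !big_ord1 !mxE.
  by rewrite divr1 !mulr1.
have uE : A + (alpha / 1%:R) *: (ones R 1 *m (ones R 1)^T) \in unitmx.
  rewrite unitmxE det_mx11 unitfE !mxE !big_ord1 !mxE divr1 !mulr1.
  by rewrite gt_eqF // ltr_wpDl.
move: ev; rewrite /jump_walk EB mulVmx // mul1mx => /eqP.
rewrite -subr_eq0 -[v in v - _]scale1r -scalerBl scaler_eq0 (negbTE v0) orbF.
by rewrite subr_eq0 => /eqP.
Qed.

(** The proviso at [a = 0] concerns bipartite graphs: there -1 is ignored by the gap at 0, whereas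
    for small positive jump rates the eigenvalue near -1 counts. *)
Theorem corollary2 (R : realType) (n : nat) (A : 'M[R]_n)
    (hG : connected_weighted_graph A) :
  exists2 eps : R, 0 < eps &
    forall (lambda : R -> R) (v : R -> 'cV[R]_n) (mu : R -> R) (a b : R),
      0 <= a -> a < b -> b < eps ->
      (a = 0 -> ~~ eigenvalue (jump_walk A 0) (-1)) ->
      (forall alpha : R, a < alpha -> alpha < b ->
        [/\ is_lambda_star (jump_walk A alpha) (lambda alpha),
            is_eigenvector (jump_walk A alpha) (lambda alpha) (v alpha),
            sign_proportions (v alpha) (mu alpha) &
            spectral_gap (jump_walk A 0) < Num.min (mu alpha) (1 - mu alpha)]) ->
      relaxation_time (jump_walk A b) < relaxation_time (jump_walk A a).
Proof.
have [nle1|n1] := leqP n 1.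
  exists 1 => // lambda v mu a b a0 ab _ _ H; exfalso.
  have [||[_ l1 _ _] ev _ _] := H ((a + b) / 2); [lra|lra|].
  have [_ A0 _] := hG.
  have c0 : 0 < (a + b) / 2 by lra.
  by rewrite (jump_walk_order_le1 nle1 A0 c0 ev) eqxx in l1.
have n0 : 0 < n%:R :> R by rewrite ltr0n ltnW.
(* A gap of 1, here or through [L <= 0], contradicts the sign condition, since the smaller
   proportion is at most 1/2. *)
have [gap1|[l0 [el0 l01 l0N1 _] gapL]] := spectral_gapP (jump_walk A 0).
  exists 1 => // lambda v mu a b a0 ab _ _ H; exfalso.
  have [||_ _ _] := H ((a + b) / 2); [lra|lra|].
  by rewrite gap1 lt_min => /andP[]; lra.
set L := `|l0| in gapL.
have L1 : L < 1 := jump_walk_eigenvalue_lt1 hG n1 (lexx 0) el0 l01 l0N1.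
have [L0|Lpos] := leP L 0.
  exists 1 => // lambda v mu a b a0 ab _ _ H; exfalso.
  have [||_ _ _] := H ((a + b) / 2); [lra|lra|].
  by rewrite gapL lt_min => /andP[]; lra.
have [d d0 hd] := nat_ratio_gap n Lpos.
have dL : d <= L by have := hd ord0; rewrite mul0r add0r => ->.
have V0 := vol_gt0 hG n1.
set V := mxform _ _ _ in V0.
(* Half of [d] pays for semicontinuity at 0; the other half is the slack for [eigenvalue_decr]. *)
have r0 : 0 <= L - d / 2 by lra.
have rL : L - d / 2 < L by lra.
have [eta eta0 heta] := eigenvalue_lsc hG n1 (lexx 0) r0 rL L1 el0.
exists (Num.min eta (V * (d / 2) / n%:R)).
  by rewrite lt_min eta0 divr_gt0 // mulr_gt0 // divr_gt0.
move=> lambda v mu a b a0 ab; rewrite lt_min => /andP[beta bV] aN1 H.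
(* -1 is not an eigenvalue at [c > 0], so only 1 has to be excluded. *)
have lambda_max c l : a < c -> c < b -> eigenvalue (jump_walk A c) l ->
    l != 1 -> `|l| <= `|lambda c|.
  move=> ac cb el l1; have [[_ _ _ hl] _ _ _] := H c ac cb.
  apply: hl => //; apply: contraTneq el => ->.
  by apply: jump_walk_eigenvalueN1 => //; apply: le_lt_trans a0 ac.
have step beta' c : 0 <= beta' -> beta' < c -> a < c -> c < b ->
    exists l, [/\ `|lambda c| < `|l|, l != 1 & eigenvalue (jump_walk A beta') l].
  move=> b0 bc ac cb.
  have c0 : 0 <= c by apply: le_trans b0 (ltW bc).
  have [[el l1 lN1 _] [v0 ev] sgn] := H c ac cb.
  rewrite gapL lt_min => /andP[hmu1 hmu2].
  have [|l [rl l1' el']] := heta c c0.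
    by rewrite sub0r normrN ger0_norm //; lra.
  have lc := lt_le_trans rl (lambda_max c l ac cb el' l1').
  have [i mi] := sign_proportions_nat (ltnW n1) sgn.
  have mL : Num.max (mu c) (1 - mu c) < L by rewrite gt_max; apply/andP; split; lra.
  have mdL : Num.max (mu c) (1 - mu c) + d <= L by rewrite mi hd // -mi.
  apply: (eigenvalue_decr hG n1 b0 bc _ _ v0 ev (d := d / 2)
    (m := Num.max (mu c) (1 - mu c))).
  - exact: (jump_walk_eigenvalue_lt1 hG n1 c0 el).
  - by rewrite -normr_gt0; lra.
  - by lra.
  - by lra.
  - exact: sign_proportions_sum.
  - by lra.
  - rewrite ltr_pdivlMr // in bV.
    by apply: le_lt_trans bV; rewrite ler_pM2r //; lra.
(* An interior point separates the endpoints: the comparison is strict from [a] to [c] and weak from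
   [c] to [b]. *)
have [c ac cb] : exists2 c, a < c & c < b by exists ((a + b) / 2); lra.
have [l [cl l1 el]] := step a c a0 ac ac cb.
have lN1 : l != -1.
  apply: contraTneq el => ->; have [a00|an0] := eqVneq a 0; first by rewrite a00 aN1.
  by apply: jump_walk_eigenvalueN1 => //; rewrite lt0r an0.
have [la hla lla] := lambda_star_exists el l1 lN1.
have la1 : `|la| < 1.
  by have [ela la1 laN1 _] := hla; apply: (jump_walk_eigenvalue_lt1 hG n1 a0).
(* Otherwise semicontinuity at [b] gives a [c'] between [c] and [b] whose [lambda c'] exceeds
   [lambda c] in modulus, while [step] from [c'] down to [c] gives the reverse. *)
have gb : 1 - `|lambda c| <= spectral_gap (jump_walk A b).
  have [->|[lb [elb lb1 lbN1 _] ->]] := spectral_gapP (jump_walk A b).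
    by have := normr_ge0 (lambda c); lra.
  rewrite lerD2l lerN2 leNgt; apply/negP => clb.
  have b0 : 0 <= b by lra.
  have lb_lt1 := jump_walk_eigenvalue_lt1 hG n1 b0 elb lb1 lbN1.
  have [e e0 he] := eigenvalue_lsc hG n1 b0 (normr_ge0 _) clb lb_lt1 elb.
  have [c' [cc' c'b be']] : exists c', [/\ c < c', c' < b & b - c' < e].
    exists (Num.max ((c + b) / 2) (b - e / 2)).
    split.
    - by rewrite lt_max; apply/orP; left; lra.
    - by rewrite gt_max; apply/andP; split; lra.
    - have : b - e / 2 <= Num.max ((c + b) / 2) (b - e / 2).
        by rewrite le_max lexx orbT.
      lra.
  have ac' := lt_trans ac cc'.
  have [||l' [cl' l'1 el']] := he c'; [lra|by rewrite gtr0_norm; lra|].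
  have c0 : 0 <= c by lra.
  have [l2 [c'l2 l21 el2]] := step c c' c0 cc' ac' c'b.
  have := lambda_max c' l' ac' c'b el' l'1.
  by have := lambda_max c l2 ac cb el2 l21; lra.
have ga := lambda_star_gap hla.
have gap_lt : spectral_gap (jump_walk A a) < spectral_gap (jump_walk A b).
  by rewrite ga; apply: lt_le_trans gb; rewrite ltrD2l ltrN2 (lt_le_trans cl).
have gap_gt0 : 0 < spectral_gap (jump_walk A a) by rewrite ga subr_gt0.
have gap_gt0' := lt_trans gap_gt0 gap_lt.
move: gap_gt0 gap_gt0' gap_lt; rewrite /relaxation_time.
by move: (spectral_gap _) (spectral_gap _) => x y x0 y0; rewrite ltf_pV2.
Qed.
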